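(* There is a locally Lipschitz function $F_{2,4}\colon\mathbb{R}^{2\times 4}\to[0,\infty)$, obtained by restricting $G_{\mathrm{im}}^T$ to an affine subspace of $\mathbb{R}^{2\times 6}$ (that is, $F_{2,4}(A)=G_{\mathrm{im}}^T(M+\iota(A))$ for all $A\in\mathbb{R}^{2\times 4}$, for some $M\in\mathbb{R}^{2\times 6}$ and some injective linear map $\iota\colon\mathbb{R}^{2\times 4}\to\mathbb{R}^{2\times 6}$), such that $F_{2,4}$ is rank-one convex but not quasiconvex.
   Context: Let $\mathbb{T}^n$ be the periodic torus (e.g. $\mathbb{T}^n=\mathbb{R}^n/(2\pi\mathbb{Z})^n$). A locally Lipschitz function $F\colon\mathbb{R}^{m\times n}\to\mathbb{R}$ is called quasiconvex if for all $A\in\mathbb{R}^{m\times n}$ and all $\varphi\in C^\infty(\mathbb{T}^n,\mathbb{R}^m)$, $\int_{\mathbb{T}^n}[F(A+D\varphi)-F(A)]\,dx\ge 0$; it is called rank-one convex if for all $A,X\in\mathbb{R}^{m\times n}$ with $\operatorname{rank}(X)=1$ the function $t\mapsto F(A+tX)$ is convex on $\mathbb{R}$. $\mathbb{H}$ denotes the real quaternions with units $\mathbf{i},\mathbf{j},\mathbf{k}$, and $\operatorname{Im}\mathbb{H}=\{w_1\mathbf{i}+w_2\mathbf{j}+w_3\mathbf{k}: (w_1,w_2,w_3)\in\mathbb{R}^3\}$ the purely imaginary quaternions. For $\xi=(\xi_1,\xi_2),\eta=(\eta_1,\eta_2)\in\mathbb{H}^2$ set $\langle\xi,\eta\rangle_{\mathbb{H}^2}:=\xi_1\overline{\eta_1}+\xi_2\overline{\eta_2}\in\mathbb{H}$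 and $\|\xi\|_{\mathbb{H}^2}^2:=\langle\xi,\xi\rangle_{\mathbb{H}^2}=|\xi_1|^2+|\xi_2|^2$. Define $$G\colon\mathbb{H}^2\times\mathbb{H}^2\to[0,\infty),\qquad G(\xi,\eta):=\sqrt{\|\xi\|_{\mathbb{H}^2}^2\|\eta\|_{\mathbb{H}^2}^2-|\langle\xi,\eta\rangle_{\mathbb{H}^2}|^2}.$$ Identify $(\operatorname{Im}\mathbb{H})^2\cong\mathbb{R}^6$ via $(u_1\mathbf{i}+u_2\mathbf{j}+u_3\mathbf{k},\,v_1\mathbf{i}+v_2\mathbf{j}+v_3\mathbf{k})\leftrightarrow(u_1,u_2,u_3,v_1,v_2,v_3)$, and regard a pair $(\xi,\eta)\in(\operatorname{Im}\mathbb{H})^2\times(\operatorname{Im}\mathbb{H})^2$ as the matrix in $\mathbb{R}^{6\times 2}$ with columns $\xi,\eta$. Let $G_{\mathrm{im}}\colon\mathbb{R}^{6\times 2}\to[0,\infty)$ be the restriction of $G$ to $(\operatorname{Im}\mathbb{H})^2\times(\operatorname{Im}\mathbb{H})^2$, and $G_{\mathrm{im}}^T\colon\mathbb{R}^{2\times 6}\to[0,\infty)$, $G_{\mathrm{im}}^T(A):=G_{\mathrm{im}}(A^T)$. *)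

(* Defs.v *)
(* Mathematical Components with MathComp-Analysis *)
From HB Require Import structures.
From mathcomp Require Import all_boot all_order all_algebra.
From mathcomp Require Import all_classical all_reals all_analysis.
From mathcomp Require Import ring.

Set Implicit Arguments.
Unset Strict Implicit.
Unset Printing Implicit Defensive.

Import Order.TTheory GRing.Theory Num.Theory.
Import numFieldNormedType.Exports.

Local Open Scope classical_set_scope.
Local Open Scope ring_scope.

Section Quaternions.
Context {R : realType}.

(* Quat a b c d is a + b i + c j + d k. *)
Record quat := Quat { qre : R; qi : R; qj : R; qk : R }.

Definition addq (p q : quat) : quat :=
  Quat (qre p + qre q) (qi p + qi q) (qj p + qj q) (qk p + qk q).

Definition mulq (p q : quat) : quat :=
  let: Quat a1 b1 c1 d1 := p in
  let: Quat a2 b2 c2 d2 := q in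
  Quat (a1 * a2 - b1 * b2 - c1 * c2 - d1 * d2)
       (a1 * b2 + b1 * a2 + c1 * d2 - d1 * c2)
       (a1 * c2 - b1 * d2 + c1 * a2 + d1 * b2)
       (a1 * d2 + b1 * c2 - c1 * b2 + d1 * a2).

Definition conjq (q : quat) : quat := Quat (qre q) (- qi q) (- qj q) (- qk q).

Definition normq (q : quat) : R :=
  Num.sqrt (qre q ^+ 2 + qi q ^+ 2 + qj q ^+ 2 + qk q ^+ 2).

Definition dotH2 (xi eta : quat * quat) : quat :=
  addq (mulq xi.1 (conjq eta.1)) (mulq xi.2 (conjq eta.2)).

Definition sqnormH2 (xi : quat * quat) : R := normq xi.1 ^+ 2 + normq xi.2 ^+ 2.

Lemma dotH2_diag (xi : quat * quat) : dotH2 xi xi = Quat (sqnormH2 xi) 0 0 0.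
Proof.
case: xi => [[a1 b1 c1 d1] [a2 b2 c2 d2]].
rewrite /dotH2 /sqnormH2 /addq /mulq /conjq /normq /= !sqr_sqrtr; last 2 first.
- by rewrite !addr_ge0 ?sqr_ge0.
- by rewrite !addr_ge0 ?sqr_ge0.
by congr Quat; ring.
Qed.

Definition G (xi eta : quat * quat) : R :=
  Num.sqrt (sqnormH2 xi * sqnormH2 eta - normq (dotH2 xi eta) ^+ 2).

Definition imH2 (w : 'cV[R]_6) : quat * quat :=
  let c k (hk : (k < 6)%N) := w (Ordinal hk) ord0 in
  (Quat 0 (c 0 isT) (c 1 isT) (c 2 isT), Quat 0 (c 3 isT) (c 4 isT) (c 5 isT)).

Definition Gim (A : 'M[R]_(6, 2)) : R :=
  G (imH2 (col ord0 A)) (imH2 (col ord_max A)).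

Definition GimT (A : 'M[R]_(2, 6)) : R := Gim A^T.

End Quaternions.
Arguments quat R : clear implicits.

Section LebesgueMeasure.
Local Open Scope ereal_scope.
Context {R : realType}.

(* lebesgueT n is Lebesgue measure on the n-tuples of reals, built by recursion
   on n as the product of the one-dimensional Lebesgue measure with lebesgueT
   n.-1, transported along consT. *)
Definition consT n (p : measurableTypeR R * n.-tuple (measurableTypeR R)) :
  n.+1.-tuple (measurableTypeR R) := [tuple of p.1 :: p.2].

Lemma measurable_consT n : measurable_fun [set: _] (@consT n).
Proof. exact: measurable_cons. Qed.

Section LebesgueStep.
Variables (n : nat)
  (m : {sigma_finite_measure set (n.-tuple (measurableTypeR R)) -> \bar R}).

Definition lebesgue_consT : set (n.+1.-tuple (measurableTypeR R)) -> \bar R :=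
  pushforward (@lebesgue_measure R \x m) (@consT n).

Let consT_measure : {measure set _ -> \bar R} :=
  measure_function_pushforward__canonical__measure_function_Measure
    (@lebesgue_measure R \x m) (@measurable_consT n).

Let lebesgue_consT0 : lebesgue_consT set0 = 0.
Proof. exact: (measure0 consT_measure). Qed.

Let lebesgue_consT_ge0 A : 0 <= lebesgue_consT A.
Proof. exact: (measure_ge0 consT_measure). Qed.

Let lebesgue_consT_sigma_additive : semi_sigma_additive lebesgue_consT.
Proof. exact: (@measure_semi_sigma_additive _ _ _ consT_measure). Qed.

HB.instance Definition _ := isMeasure.Build _ _ _ lebesgue_consT
  lebesgue_consT0 lebesgue_consT_ge0 lebesgue_consT_sigma_additive.

Let lebesgue_consT_sigma_finite : sigma_finite setT lebesgue_consT.
Proof.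
have /sigma_finiteP[F [TF ndF Foo]] := sigma_finiteT (@lebesgue_measure R).
have /sigma_finiteP[G [TG ndG Goo]] := sigma_finiteT m.
pose uncons (t : n.+1.-tuple (measurableTypeR R)) :
  measurableTypeR R * n.-tuple (measurableTypeR R) :=
  (tnth t ord0, [tuple of behead t]).
have muncons : measurable_fun setT uncons.
  apply: measurable_fun_pair; first exact: measurable_tnth.
  exact: measurable_behead.
have consTK : cancel (@consT n) uncons.
  by case=> x t; congr pair; apply/val_inj.
exists (fun i => uncons @^-1` (F i `*` G i)).
  apply/esym/seteqP; split=> // t _.
  have [i _ Fi] : (\bigcup_i F i) (uncons t).1 by rewrite -TF.
  have [j _ Gj] : (\bigcup_i G i) (uncons t).2 by rewrite -TG.
  exists (maxn i j) => //; split.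
  - by move: (uncons t).1 Fi; exact/subsetPset/ndF/leq_maxl.
  - by move: (uncons t).2 Gj; exact/subsetPset/ndG/leq_maxr.
move=> i; have [mF Fi] := Foo i; have [mG Gi] := Goo i; split.
  by rewrite -[X in measurable X]setTI; apply: muncons => //; exact: measurableX.
rewrite /lebesgue_consT /pushforward -comp_preimage.
rewrite (_ : uncons \o @consT n = id); last first.
  by apply/funext => x /=; exact: consTK.
by rewrite preimage_id product_measure1E// lte_mul_pinfty// ge0_fin_numE.
Qed.

HB.instance Definition _ := Measure_isSigmaFinite.Build _ _ _ lebesgue_consT
  lebesgue_consT_sigma_finite.

End LebesgueStep.

Fixpoint lebesgueT (n : nat) :
    {sigma_finite_measure set (n.-tuple (measurableTypeR R)) -> \bar R} :=
  if n is n'.+1 then lebesgue_consT (lebesgueT n') else \d_[tuple].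

End LebesgueMeasure.

Section Quasiconvexity.
Context {R : realType}.

Definition partial n (W : normedModType R) (j : 'I_n) (f : 'rV[R]_n -> W) :
  'rV[R]_n -> W := fun x => 'D_(delta_mx ord0 j) f x.

Definition smooth n (f : 'rV[R]_n -> R) : Prop :=
  forall s : seq 'I_n, let g := foldr (@partial n R) f s in
    continuous g /\ forall (j : 'I_n) x, derivable g x (delta_mx ord0 j).

(* Functions on the torus R^n / (2 pi Z)^n are identified with the functions
   on R^n that are 2 pi periodic in each variable. *)
Definition torus_periodic n T (f : 'rV[R]_n -> T) : Prop :=
  forall (j : 'I_n) x, f (x + (2 * pi) *: delta_mx ord0 j) = f x.

Definition smooth_torus m n (phi : 'rV[R]_n -> 'rV[R]_m) : Prop :=
  torus_periodic phi /\ forall i : 'I_m, smooth (fun x => phi x ord0 i).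

Definition grad m n (phi : 'rV[R]_n -> 'rV[R]_m) (x : 'rV[R]_n) : 'M[R]_(m, n) :=
  \matrix_(i, j) partial j (fun y => phi y ord0 i) x.

(* The integral over the fundamental domain [0, 2 pi]^n. *)
Definition torus_int n (f : 'rV[R]_n -> R) : R :=
  \int[lebesgueT n]_(t in [set t : n.-tuple (measurableTypeR R) |
       forall j, tnth t j \in `[0%R, (2 * pi)%R]]) f (\row_j tnth t j).

Definition locally_lipschitz m n (F : 'M[R]_(m, n) -> R) : Prop :=
  forall A : 'M[R]_(m, n), exists2 U, nbhs A U & [lipschitz F B | B in U].

Definition quasiconvex m n (F : 'M[R]_(m, n) -> R) : Prop :=
  forall (A : 'M[R]_(m, n)) (phi : 'rV[R]_n -> 'rV[R]_m),
    smooth_torus phi -> 0 <= torus_int (fun x => F (A + grad phi x) - F A).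

Definition rank_one_convex m n (F : 'M[R]_(m, n) -> R) : Prop :=
  forall A X : 'M[R]_(m, n), \rank X = 1%N ->
    convex_function (E := R^o) setT (fun t : R => F (A + t *: X)).

End Quasiconvexity.

(* Main.v *)
Require Import Defs.
From HB Require Import structures.
From mathcomp Require Import all_boot all_order all_algebra.
From mathcomp Require Import all_classical all_reals all_analysis.
From mathcomp Require Import measurable_realfun ring lra.
Import Order.TTheory GRing.Theory Num.Theory.
Import numFieldNormedType.Exports.
Local Open Scope classical_set_scope.
Local Open Scope ring_scope.

Set Implicit Arguments.
Unset Strict Implicit.
Unset Printing Implicit Defensive.

(** Rank-one convexity. G(xi, eta) is the Dieudonne determinant of the quaternionic
    matrix with rows xi and eta: it equals |eta| times the distance from xi to the
    quaternionic line spanned by eta. So G is a seminorm in each row, and it does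
    not change when a real multiple of one row is added to the other. Such a shear
    turns a line of rank-one direction into one along which a single row moves,
    and a seminorm is convex along it ([GimT_rank_one]). The seminorm property also
    gives the Lipschitz bound ([dieudonne_lip]). Both pass to the restriction F24 of
    GimT to the affine slice defined by [slice_base] and [slice_embed].

    Failure of quasiconvexity. On the slice, A is the gradient of a pair (f, g) of
    functions of four variables x, X, y, Y, and F24 0 = 1. Put a = (f_x, f_X),
    b = (f_y, f_Y), c = (g_x, g_X), and suppose that f_x + g_y = f_X + g_Y = 0. Then
    F24^2 = (1 + m)^2 + H with m = |a|^2 + b . c and
    H = (b x c)^2 - 4 (a x b) (a x c)   ([F24_traceless]).
    The quadratic term m is a combination of minors of the gradient, so it has mean
    zero for periodic (f, g). Replacing (f, g) by e (f, g) gives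
    F24 = 1 + e^2 m + e^4 H / 2 + O(e^6), so quasiconvexity at 0 is violated for
    small e as soon as H has negative mean ([sqrt_perturb],
    [F24_not_quasiconvex]).

    The two linear equations are solved by superposing (- mu2, mu1) times an arbitrary
    function psi(mu1 x + mu2 y, mu1 X + mu2 Y), for directions mu in the plane. With
    p = (x, X), q = (y, Y), the directions (1, 0), (0, 1), (1, 1) and one even psi,
    take f = psi(p + q) - psi(q) and g = psi(p) - psi(p + q). Put r = - (p + q), let
    A, B, C be the gradients of psi at p, q, r, and let
    S = B x C, T = C x A, U = A x B. Then
    H = S^2 + T^2 + U^2 - 2 (S T + T U + U S).
    For psi = |p|^2 / 2 the three gradients add up to zero, like p, q and r; then
    S = T = U and H = - 3 S^2 < 0. The periodic function
    psi(s, t) = 2 (1 + cos s) (1 + cos t) - 2 keeps enough of this correlation: the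
    mean of H is - 6 ([mean_quartic_waves]). This mean is the constant Fourier
    coefficient of a trigonometric polynomial with integer data, and is computed. *)

(** * The Dieudonne determinant as a seminorm in each row *)

Section Dieudonne.
Context {R : realType}.
Implicit Types (x y k : 'rV[R]_6).

(** The squared Dieudonne determinant of the quaternionic matrix with rows
    x = (u, v) and y = (w, z), where u, v, w, z are imaginary quaternions: the
    last four squares are the real part and the i, j, k components (up to sign)
    of the pairing of x and y. *)
Definition dieudonne_sq x y : R :=
  let u1 := x 0 (inord 0) in let u2 := x 0 (inord 1) in let u3 := x 0 (inord 2) in
  let v1 := x 0 (inord 3) in let v2 := x 0 (inord 4) in let v3 := x 0 (inord 5) in
  let w1 := y 0 (inord 0) in let w2 := y 0 (inord 1) in let w3 := y 0 (inord 2) in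
  let z1 := y 0 (inord 3) in let z2 := y 0 (inord 4) in let z3 := y 0 (inord 5) in
  (u1 ^+ 2 + u2 ^+ 2 + u3 ^+ 2 + (v1 ^+ 2 + v2 ^+ 2 + v3 ^+ 2)) *
    (w1 ^+ 2 + w2 ^+ 2 + w3 ^+ 2 + (z1 ^+ 2 + z2 ^+ 2 + z3 ^+ 2)) -
  ((u1 * w1 + u2 * w2 + u3 * w3 + (v1 * z1 + v2 * z2 + v3 * z3)) ^+ 2 +
   (u2 * w3 - u3 * w2 + (v2 * z3 - v3 * z2)) ^+ 2 +
   (u3 * w1 - u1 * w3 + (v3 * z1 - v1 * z3)) ^+ 2 +
   (u1 * w2 - u2 * w1 + (v1 * z2 - v2 * z1)) ^+ 2).

Definition dieudonne x y : R := Num.sqrt (dieudonne_sq x y).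

Lemma ord6E (i : nat) (h : (i < 6)%N) : Ordinal h = inord i.
Proof. by apply: val_inj; rewrite /= inordK. Qed.

Lemma sum6E (h : 'I_6 -> R) : \sum_j h j =
  h (inord 0) + h (inord 1) + h (inord 2) + h (inord 3) + h (inord 4) + h (inord 5).
Proof. by rewrite !big_ord_recl big_ord0 addr0 !addrA /=; congr (_ + _ + _ + _ + _ + _);
  congr h; apply: val_inj; rewrite /= inordK. Qed.

Lemma GimTE (A : 'M[R]_(2, 6)) :
  GimT A = dieudonne (row 0 A) (row 1 A).
Proof.
rewrite /GimT /Gim /G /dieudonne; congr Num.sqrt.
have sqn w : @sqnormH2 R (imH2 w) =
    w (inord 0) 0 ^+ 2 + w (inord 1) 0 ^+ 2 + w (inord 2) 0 ^+ 2 +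
    (w (inord 3) 0 ^+ 2 + w (inord 4) 0 ^+ 2 + w (inord 5) 0 ^+ 2).
  rewrite /sqnormH2 /normq /imH2 /= !sqr_sqrtr ?addr_ge0 ?sqr_ge0//.
  by rewrite !ord6E expr0n /= !add0r.
rewrite !sqn /normq sqr_sqrtr; last by rewrite !addr_ge0 ?sqr_ge0.
rewrite /dotH2 /= !ord6E !mxE /dieudonne_sq !mxE.
have -> : ord_max = 1 :> 'I_2 by apply: val_inj.
ring.
Qed.

(** Cauchy-Schwarz over the quaternions: |y|^2 times the squared determinant is the
    squared norm of the vector |y|^2 x - <x, y> y, hence a sum of eight squares. *)
Lemma dieudonne_sq_ge0 x y : 0 <= dieudonne_sq x y.
Proof.
rewrite /dieudonne_sq.
set u1 := x 0 (inord 0); set u2 := x 0 (inord 1); set u3 := x 0 (inord 2).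
set v1 := x 0 (inord 3); set v2 := x 0 (inord 4); set v3 := x 0 (inord 5).
set w1 := y 0 (inord 0); set w2 := y 0 (inord 1); set w3 := y 0 (inord 2).
set z1 := y 0 (inord 3); set z2 := y 0 (inord 4); set z3 := y 0 (inord 5).
set N := w1 ^+ 2 + _ + _ + (_ + _ + _).
have : 0 <= N by rewrite !addr_ge0 ?sqr_ge0.
rewrite le_eqVlt => /orP[/eqP N0|N0].
  have sq0 t : t ^+ 2 <= N -> t = 0.
    by rewrite -N0 => t0; apply/eqP; rewrite -sqrf_eq0 eq_le t0 sqr_ge0.
  have [[s1 s2] s3] := (sqr_ge0 w1, sqr_ge0 w2, sqr_ge0 w3).
  have [[t1 t2] t3] := (sqr_ge0 z1, sqr_ge0 z2, sqr_ge0 z3).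
  have w10 : w1 = 0 by apply: sq0; rewrite /N; lra.
  have w20 : w2 = 0 by apply: sq0; rewrite /N; lra.
  have w30 : w3 = 0 by apply: sq0; rewrite /N; lra.
  have z10 : z1 = 0 by apply: sq0; rewrite /N; lra.
  have z20 : z2 = 0 by apply: sq0; rewrite /N; lra.
  have z30 : z3 = 0 by apply: sq0; rewrite /N; lra.
  rewrite -N0 w10 w20 w30 z10 z20 z30.
  by rewrite !(mulr0, subr0, addr0, expr0n).
set d0 := u1 * w1 + _ + _ + _; set d1 := u2 * w3 - _ + _.
set d2 := u3 * w1 - _ + _; set d3 := u1 * w2 - _ + _.
rewrite -(pmulr_rge0 _ N0).
have -> : N * ((u1 ^+ 2 + u2 ^+ 2 + u3 ^+ 2 + (v1 ^+ 2 + v2 ^+ 2 + v3 ^+ 2)) * N -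
    (d0 ^+ 2 + d1 ^+ 2 + d2 ^+ 2 + d3 ^+ 2)) =
  (N * u1 - d0 * w1 + d2 * w3 - d3 * w2) ^+ 2 +
  (N * u2 - d0 * w2 + d3 * w1 - d1 * w3) ^+ 2 +
  (N * u3 - d0 * w3 + d1 * w2 - d2 * w1) ^+ 2 +
  (d1 * w1 + d2 * w2 + d3 * w3) ^+ 2 +
  ((N * v1 - d0 * z1 + d2 * z3 - d3 * z2) ^+ 2 +
  (N * v2 - d0 * z2 + d3 * z1 - d1 * z3) ^+ 2 +
  (N * v3 - d0 * z3 + d1 * z2 - d2 * z1) ^+ 2 +
  (d1 * z1 + d2 * z2 + d3 * z3) ^+ 2).
  by rewrite /N /d0 /d1 /d2 /d3; ring.
by rewrite !addr_ge0 ?sqr_ge0.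
Qed.

(** The triangle inequality for the square root of a positive semidefinite
    binary quadratic form with coefficients p, b, q. *)
Lemma sqrt_triangle (p q b : R) :
  (forall s t, 0 <= s ^+ 2 * p + 2 * s * t * b + t ^+ 2 * q) ->
  Num.sqrt (p + 2 * b + q) <= Num.sqrt p + Num.sqrt q.
Proof.
move=> psd.
have p0 : 0 <= p by have := psd 1 0; lra.
have q0 : 0 <= q by have := psd 0 1; lra.
have bb : b ^+ 2 <= p * q.
  have [q00|q_neq0] := eqVneq q 0.
    have [b0|b_neq0] := eqVneq b 0; first by rewrite q00 b0; lra.
    (* the form is affine in t when q = 0: evaluate it where it equals -1 *)
    have := psd 1 (- (p + 1) / (2 * b)).
    have -> : 1 ^+ 2 * p + 2 * 1 * (- (p + 1) / (2 * b)) * b +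
              (- (p + 1) / (2 * b)) ^+ 2 * q = -1.
      by rewrite q00; field.
    lra.
  have qpos : 0 < q by rewrite lt0r q_neq0.
  rewrite -subr_ge0 -(pmulr_rge0 _ qpos); have := psd q (- b); lra.
rewrite -[leRHS]ger0_norm ?addr_ge0 ?sqrtr_ge0// -sqrtr_sqr ler_wsqrtr//.
rewrite sqrrD !sqr_sqrtr// -sqrtrM//.
have -> : p + 2 * b + q = p + q + b *+ 2 by ring.
have -> : p + Num.sqrt (p * q) *+ 2 + q = p + q + Num.sqrt (p * q) *+ 2 by ring.
rewrite lerD2l lerMn2r; apply: le_trans (ler_norm b) _.
by rewrite -sqrtr_sqr ler_wsqrtr.
Qed.

Lemma dieudonneC x y : dieudonne x y = dieudonne y x.
Proof. by congr Num.sqrt; rewrite /dieudonne_sq; ring. Qed.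

Lemma dieudonne_shear x y (c : R) : dieudonne x (y + c *: x) = dieudonne x y.
Proof. by congr Num.sqrt; rewrite /dieudonne_sq !mxE; ring. Qed.

Lemma dieudonne_sqD (s t : R) x k y :
  dieudonne_sq (s *: x + t *: k) y =
  s ^+ 2 * dieudonne_sq x y +
  2 * s * t * ((dieudonne_sq (x + k) y - dieudonne_sq x y - dieudonne_sq k y) / 2) +
  t ^+ 2 * dieudonne_sq k y.
Proof. by rewrite /dieudonne_sq !mxE; field. Qed.

Lemma dieudonneZ (t : R) x y : dieudonne (t *: x) y = `|t| * dieudonne x y.
Proof.
rewrite /dieudonne -[t *: x]addr0 -{1}(scale0r x) dieudonne_sqD expr0n /=.
by rewrite mulr0 !mul0r !addr0 sqrtrM ?sqr_ge0// sqrtr_sqr.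
Qed.

(** Together with [dieudonneZ]: for fixed y the determinant is a seminorm in x,
    namely |y| times the distance from x to the quaternionic line spanned by y. *)
Lemma dieudonneD x k y : dieudonne (x + k) y <= dieudonne x y + dieudonne k y.
Proof.
rewrite /dieudonne; set b := (dieudonne_sq (x + k) y - dieudonne_sq x y - dieudonne_sq k y) / 2.
have -> : dieudonne_sq (x + k) y = dieudonne_sq x y + 2 * b + dieudonne_sq k y.
  by rewrite /b; field.
apply: sqrt_triangle => s t.
by rewrite -dieudonne_sqD dieudonne_sq_ge0.
Qed.

Lemma dieudonne_sum_le x y :
  dieudonne_sq x y <= (\sum_j x 0 j ^+ 2) * (\sum_j y 0 j ^+ 2).
Proof.
rewrite !sum6E /dieudonne_sq !addrA lerBlDr lerDl.
by rewrite !addr_ge0 ?sqr_ge0.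
Qed.

Lemma entry_le_norm m n (A : 'M[R]_(m, n)) i j : `|A i j| <= `|A|.
Proof.
by rewrite [leRHS]/Num.Def.normr /= mx_normrE; apply/bigmax_geP; right => /=; exists (i, j).
Qed.

Lemma norm_le_entry m n (A : 'M[R]_(m, n)) (c : R) : 0 <= c ->
  (forall i j, `|A i j| <= c) -> `|A| <= c.
Proof.
move=> c0 Ac; rewrite [leLHS]/Num.Def.normr /= mx_normrE.
by apply: bigmax_le => //= -[i j] _; exact: Ac.
Qed.

Lemma dieudonne_le_norm x y : dieudonne x y <= 6 * `|x| * `|y|.
Proof.
have sq_le (z : 'rV[R]_6) : \sum_j z 0 j ^+ 2 <= 6 * `|z| ^+ 2.
  have -> : 6 * `|z| ^+ 2 = \sum_(j < 6) `|z| ^+ 2.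
    by rewrite sumr_const card_ord mulr_natl.
  apply: ler_sum => j _; rewrite -[leLHS]ger0_norm ?sqr_ge0// normrX.
  by rewrite lerXn2r ?nnegrE// entry_le_norm.
have -> : 6 * `|x| * `|y| = Num.sqrt ((6 * `|x| * `|y|) ^+ 2).
  by rewrite sqrtr_sqr ger0_norm ?mulr_ge0.
rewrite ler_wsqrtr//; apply: le_trans (dieudonne_sum_le x y) _.
have -> : (6 * `|x| * `|y|) ^+ 2 = (6 * `|x| ^+ 2) * (6 * `|y| ^+ 2) by ring.
by apply: ler_pM; rewrite ?sumr_ge0// => j _; rewrite sqr_ge0.
Qed.

Lemma dieudonne_lip x x' y y' :
  `|dieudonne x y - dieudonne x' y'| <=
  6 * `|x - x'| * `|y| + 6 * `|x'| * `|y - y'|.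
Proof.
have lip1 (z z' w : 'rV[R]_6) : `|dieudonne z w - dieudonne z' w| <= 6 * `|z - z'| * `|w|.
  apply: le_trans (dieudonne_le_norm _ _).
  rewrite ler_norml; apply/andP; split.
    rewrite lerNl opprB lerBlDl -[X in dieudonne X w <= _](subrKC z).
    by rewrite (le_trans (dieudonneD _ _ _))// lerD2l -opprB -scaleN1r dieudonneZ normrN1 mul1r.
  by rewrite lerBlDl -[X in dieudonne X w <= _](subrKC z') dieudonneD.
have -> : dieudonne x y - dieudonne x' y' =
  (dieudonne x y - dieudonne x' y) + (dieudonne y x' - dieudonne y' x').
  by rewrite (dieudonneC y x') (dieudonneC y' x'); ring.
apply: le_trans (ler_normD _ _) _; apply: lerD; first exact: lip1.
by apply: le_trans (lip1 _ _ _) _; rewrite mulrAC.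
Qed.

Lemma convex_dieudonne_line x k y :
  convex_function (E := R^o) setT (fun t : R => dieudonne (x + t *: k) y).
Proof.
move=> p s t _ _.
pose p' : R := p%:num; pose q := 1 - p'.
rewrite convRE [X in dieudonne (x + X *: k) y]convRE -/p'.
rewrite -[X in (p' * s + X * t)]/q -[X in _ <= _ + X * _]/q.
have pq : p' + q = 1 by rewrite /q addrC subrK.
have p0 : 0 <= p' by rewrite /p'.
have q0 : 0 <= q by rewrite /q subr_ge0 /p' le1.
have -> : x + (p' * s + q * t) *: k = p' *: (x + s *: k) + q *: (x + t *: k).
  by rewrite !scalerDr addrACA -scalerDl pq scale1r !scalerA -scalerDl.
by rewrite (le_trans (dieudonneD _ _ _))// !dieudonneZ !ger0_norm.
Qed.

(** Both rows move along the line, by t l_0 k and t l_1 k. A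
    real multiple of one row may be subtracted from the other without changing
    the determinant, and this makes one of them stationary; a seminorm in the
    other row remains. *)
Lemma GimT_rank_one (A : 'M[R]_(2, 6)) (l : 'cV[R]_2) k :
  convex_function (E := R^o) setT (fun t : R => GimT (A + t *: (l *m k))).
Proof.
pose x := row 0 A; pose y := row 1 A.
have rowE i t : row i (A + t *: (l *m k)) = row i A + (t * l i 0) *: k.
  apply/rowP => j; rewrite !mxE; congr (_ + _).
  by rewrite big_ord1 mulrA.
have [l0|l0] := eqVneq (l 0 0) 0.
  suff -> : (fun t => GimT (A + t *: (l *m k))) =
            (fun t => dieudonne (y + t *: (l 1 0 *: k)) x).
    exact: convex_dieudonne_line.
  apply/funext => t.
  by rewrite GimTE !rowE l0 mulr0 scale0r addr0 dieudonneC scalerA.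
suff -> : (fun t => GimT (A + t *: (l *m k))) =
          (fun t => dieudonne (x + t *: (l 0 0 *: k)) (y - (l 1 0 / l 0 0) *: x)).
  exact: convex_dieudonne_line.
apply/funext => t; rewrite GimTE !rowE -/x -/y -(dieudonne_shear _ _ (- (l 1 0 / l 0 0))) scalerA.
congr dieudonne; apply/rowP => j; rewrite !mxE; field.
exact: l0.
Qed.

End Dieudonne.

(** * The affine slice *)

Section Slice.
Context {R : realType}.

Lemma rank1_mulmx m n (X : 'M[R]_(m, n)) : \rank X = 1%N ->
  exists (l : 'cV[R]_m) (k : 'rV[R]_n), X = l *m k.
Proof.
move=> X1; move: (col_base X) (row_base X) (mulmx_base X); rewrite X1 => l k <-.
by exists l, k.
Qed.

Lemma norm_mulmx_le m n p (A : 'M[R]_(m, n)) (B : 'M[R]_(n, p)) :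
  `|A *m B| <= n%:R * `|B| * `|A|.
Proof.
apply: norm_le_entry => [|i j]; first by rewrite !mulr_ge0.
rewrite mxE; apply: le_trans (ler_norm_sum _ _ _) _.
have -> : n%:R * `|B| * `|A| = \sum_(k < n) `|A| * `|B|.
  by rewrite sumr_const card_ord -mulrA mulr_natl [`|B| * _]mulrC.
by apply: ler_sum => k _; rewrite normrM ler_pM// entry_le_norm.
Qed.

Lemma norm_row_le m n (A : 'M[R]_(m, n)) i : `|row i A| <= `|A|.
Proof. by apply: norm_le_entry => // i0 j; rewrite mxE entry_le_norm. Qed.

Lemma GimT_lip (A B : 'M[R]_(2, 6)) :
  `|GimT A - GimT B| <= 6 * (`|A| + `|B|) * `|A - B|.
Proof.
rewrite !GimTE; apply: le_trans (dieudonne_lip _ _ _ _) _.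
have rowB i : row i A - row i B = row i (A - B) by rewrite linearB.
rewrite !rowB mulrDr mulrDl.
apply: lerD; last by rewrite -!mulrA ler_wpM2l// ler_pM ?norm_row_le.
by rewrite -!mulrA ler_wpM2l// mulrC ler_pM ?norm_row_le.
Qed.

(** With rows (u, v) and (w, z) as above, the slice fixes the first coordinates
    u1 = z1 = 1 and v1 = w1 = 0 and leaves the other eight entries free. *)
Definition slice_base : 'M[R]_(2, 6) := \matrix_(i, j) (j == (3 * i)%N :> nat)%:R.

Definition slice_embed : 'M[R]_(4, 6) :=
  \matrix_(i, j) (j == nth 0%N [:: 1; 2; 4; 5]%N i :> nat)%:R.

Definition F24 (A : 'M[R]_(2, 4)) : R := GimT (slice_base + A *m slice_embed).

Lemma F24_ge0 A : 0 <= F24 A.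
Proof. by rewrite /F24 GimTE /dieudonne sqrtr_ge0. Qed.

Lemma slice_embedK : slice_embed *m slice_embed^T = 1%:M.
Proof.
apply/matrixP => i j; rewrite !mxE sum6E !mxE !inordK//.
case: i => -[|[|[|[|//]]]] hi; case: j => -[|[|[|[|//]]]] hj;
  by rewrite /= !(mulr0, mul0r, mulr1, mul1r, addr0, add0r).
Qed.

Lemma slice_embed_inj : injective (mulmxr slice_embed : 'M[R]_(2, 4) -> _).
Proof.
apply: (can_inj (g := fun B => B *m slice_embed^T)) => A /=.
by rewrite -mulmxA slice_embedK mulmx1.
Qed.

Lemma F24_rank_one_convex : rank_one_convex F24.
Proof.
move=> A X /rank1_mulmx[l [k ->]].
rewrite (_ : (fun t => _) = (fun t : R =>
    GimT (slice_base + A *m slice_embed + t *: (l *m (k *m slice_embed))))).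
  exact: GimT_rank_one.
by apply/funext => t; rewrite /F24 mulmxDl -scalemxAl addrA mulmxA.
Qed.

Lemma F24_locally_lipschitz : locally_lipschitz F24.
Proof.
move=> A; exists (ball A 1); first exact: nbhsx_ballx.
pose c := 4 * `|slice_embed|.
pose r := `|slice_base| + c * (`|A| + 1).
have bnd B : ball A 1 B -> `|slice_base + B *m slice_embed| <= r.
  move=> AB; rewrite /r; apply: le_trans (ler_normD _ _) _; rewrite lerD2l.
  apply: le_trans (norm_mulmx_le _ _) _; rewrite ler_wpM2l ?mulr_ge0//.
  move: AB; rewrite -ball_normE /= => /ltW AB.
  rewrite -[B](subKr A); apply: le_trans (ler_normB _ _) _.
  by rewrite lerD2l.
have PF : ProperFilter (globally (ball A 1 `*` ball A 1)).
  by apply: (globally_properfilter (a := (A, A))); split; exact: ballxx.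
apply: (@klipschitzW _ _ _ (6 * (r + r) * c)).
move=> /= [B B'] [/= AB AB'].
apply: le_trans (GimT_lip _ _) _; rewrite -mulrA.
have -> : slice_base + B *m slice_embed - (slice_base + B' *m slice_embed) =
          (B - B') *m slice_embed.
  by rewrite mulmxBl opprD addrACA subrr add0r.
rewrite -!mulrA ler_wpM2l//; apply: ler_pM; rewrite ?addr_ge0 ?lerD ?bnd//.
by rewrite mulrA; exact: norm_mulmx_le.
Qed.

(** The columns of A are indexed by variables x, X, y, Y. If A is the gradient of
    (f, g) with f_x + g_y = f_X + g_Y = 0, then a = (f_x, f_X), b = (f_y, f_Y) and
    c = (g_x, g_X) determine it, and F24^2 is a perfect square up to a quartic
    remainder, which is the resultant of two binary quadratic forms and takes
    both signs. *)
Lemma F24_traceless (A : 'M[R]_(2, 4)) (a1 a2 b1 b2 c1 c2 : R) :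
  A = \matrix_(i, j) nth 0 (nth [::] [:: [:: a1; a2; b1; b2]; [:: c1; c2; - a1; - a2]] i) j ->
  F24 A ^+ 2 = (1 + (a1 ^+ 2 + a2 ^+ 2 + b1 * c1 + b2 * c2)) ^+ 2 +
    ((b1 * c2 - b2 * c1) ^+ 2 - 4 * (a1 * b2 - a2 * b1) * (a1 * c2 - a2 * c1)).
Proof.
move=> ->; rewrite /F24 GimTE /dieudonne sqr_sqrtr ?dieudonne_sq_ge0//.
set X := row 0 _; set Y := row 1 _.
have XE (j : nat) : (j < 6)%N -> X 0 (inord j) = nth 0 [:: 1; a1; a2; 0; b1; b2] j.
  move=> j6; rewrite !mxE inordK//= !big_ord_recl big_ord0 !mxE inordK//=.
  by move: j j6 => [|[|[|[|[|[|//]]]]]] _ /=; rewrite ?(mulr1, mulr0, addr0, add0r).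
have YE (j : nat) : (j < 6)%N -> Y 0 (inord j) = nth 0 [:: 0; c1; c2; 1; - a1; - a2] j.
  move=> j6; rewrite !mxE inordK//= !big_ord_recl big_ord0 !mxE inordK//=.
  by move: j j6 => [|[|[|[|[|[|//]]]]]] _ /=; rewrite ?(mulr1, mulr0, addr0, add0r).
rewrite /dieudonne_sq !XE// !YE//=; ring.
Qed.

End Slice.

(** * Trigonometric polynomials *)

Section Trig.
Context {R : realType} {n : nat}.
Implicit Types (x v : 'rV[R]_n) (k : seq int) (L : seq (int * seq int)) (b : bool).

Definition phase k x : R := \sum_(j < n) (k`_j)%:~R * x 0 j.

Definition wave b k x : R := (if b then sin else cos) (phase k x).

(** A trigonometric polynomial is given by its list of coefficients and
    frequencies, with b selecting sines or cosines. Derivatives alternate the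
    two kinds, so parity need not be recorded wave by wave; integer data let
    Fourier coefficients be computed. *)
Definition trig b L x : R := \sum_(ck <- L) ck.1%:~R * wave b ck.2 x.

Definition dtrig b (j : 'I_n) L : seq (int * seq int) :=
  [seq ((if b then ck.1 else - ck.1) * ck.2`_j, ck.2) | ck <- L].

Lemma phase_shift k x (j : 'I_n) (h : R) :
  phase k (x + h *: delta_mx 0 j) = phase k x + (k`_j)%:~R * h.
Proof.
have -> : (k`_j)%:~R * h = \sum_(i < n) (k`_i)%:~R * (if i == j then h else 0).
  rewrite (bigD1 j) //= eqxx big1 ?addr0// => i /negPf ->.
  by rewrite mulr0.
rewrite -big_split; apply: eq_bigr => i _; rewrite !mxE eqxx /= -mulrDr.
by case: eqP => _; rewrite ?mulr1 ?mulr0.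
Qed.

Lemma is_derive_along (f : 'rV[R]_n -> R) x v (l : R) :
  is_derive (0 : R) 1 (fun h : R => f (x + h *: v)) l -> is_derive x v f l.
Proof.
case=> df <-.
have E : (fun h : R => h^-1 *: (f (h *: v + x) - f x)) =
    (fun h : R => h^-1 *: (f (x + (h *: 1 + 0) *: v) - f (x + 0 *: v))).
  by apply/funext => h; rewrite scale0r !addr0 [h *: 1]mulr1 [h *: v + x]addrC.
by split; rewrite /derivable /derive /= ?E.
Qed.

Lemma is_derive_wave b k x (j : 'I_n) :
  is_derive x (delta_mx 0 j) (wave b k)
    ((if b then 1 else -1) * (k`_j)%:~R * wave (~~ b) k x).
Proof.
apply: is_derive_along; rewrite /wave.
under eq_fun do rewrite phase_shift.
pose g := fun h : R => phase k x + (k`_j)%:~R * h.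
have da : is_derive (0 : R) (1 : R) g (k`_j)%:~R.
  rewrite (_ : g = cst (phase k x) + ((k`_j)%:~R : R) \*: (id : R -> R))//.
  by apply: is_derive_eq; rewrite add0r [LHS]mulr1.
case: b => /=.
  apply: (is_derive_eq (f' := cos (phase k x + (k`_j)%:~R * 0) * (k`_j)%:~R)).
  by rewrite mulr0 addr0 mul1r mulrC.
apply: (is_derive_eq (f' := - sin (phase k x + (k`_j)%:~R * 0) * (k`_j)%:~R)).
by rewrite mulr0 addr0 mulN1r mulrC mulrN mulNr.
Qed.

Lemma trig_cons b ck L :
  trig b (ck :: L) = (fun x => ck.1%:~R * wave b ck.2 x) + trig b L.
Proof. by apply/funext => x; rewrite /trig big_cons. Qed.

Lemma is_derive_trig b L x (j : 'I_n) :
  is_derive x (delta_mx 0 j) (trig b L) (trig (~~ b) (dtrig b j L) x).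
Proof.
elim: L => [|[c k] L IH].
  rewrite (_ : trig b [::] = cst 0); last by apply/funext => y; rewrite /trig big_nil.
  by rewrite /trig big_nil; exact: is_derive_cst.
rewrite trig_cons /= trig_cons /=; apply: is_deriveD.
apply: (is_derive_eq (f' := c%:~R *: ((if b then 1 else -1) * (k`_j)%:~R * wave (~~ b) k x))).
  by apply: is_deriveZ; exact: is_derive_wave.
rewrite rmorphM /= -[LHS]/(_ * _).
by case: (b); rewrite ?rmorphN /=; ring.
Qed.

Lemma continuous_trig b L : continuous (trig b L).
Proof.
have cphase k : continuous (phase k).
  rewrite /phase; elim: (index_enum _) => [|j s IH].
    rewrite (_ : (fun x => _) = cst 0); first exact: cst_continuous.
    by apply/funext => x; rewrite big_nil.
  rewrite (_ : (fun x => _) = (fun x : 'rV[R]_n => (k`_j)%:~R * x 0 j) +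
      (fun x => \sum_(i <- s) (k`_i)%:~R * x 0 i)); last first.
    by apply/funext => x; rewrite big_cons.
  move=> x; apply: continuousD; last exact: IH.
  apply: continuousM; [exact: cst_continuous | exact: coord_continuous].
elim: L => [|[c k] L IH].
  rewrite (_ : trig b [::] = cst 0); last by apply/funext => y; rewrite /trig big_nil.
  exact: cst_continuous.
rewrite trig_cons => x; apply: continuousD; last exact: IH.
apply: continuousM; first exact: cst_continuous.
rewrite /wave; apply: (@continuous_comp _ _ _ (phase k)); first exact: cphase.
by case: b {IH}; [exact: continuous_sin | exact: continuous_cos].
Qed.

Lemma partial_trig b L (e : R) j :
  partial j (fun x => e * trig b L x) = (fun x => e * trig (~~ b) (dtrig b j L) x).
Proof.
apply/funext => x; rewrite /partial.
exact: (@derive_val _ _ _ _ _ _ _ (@is_deriveZ _ _ _ _ e _ _ _ (is_derive_trig b L x j))).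
Qed.

Lemma smooth_trig b L (e : R) : smooth (fun x => e * trig b L x).
Proof.
move=> s.
have [b' [L' ->]] : exists b' L', foldr (@partial R n _) (fun x => e * trig b L x) s =
    (fun x => e * trig b' L' x).
  elim: s => [|j s [b' [L' /= ->]]]; first by exists b, L.
  by exists (~~ b'), (dtrig b' j L'); rewrite partial_trig.
split=> [x|j x].
  by apply: continuousM; [exact: cst_continuous | exact: continuous_trig].
have H := @is_deriveZ _ _ _ _ e _ _ _ (is_derive_trig b' L' x j).
exact: (@ex_derive _ _ _ _ _ _ _ H).
Qed.

Lemma periodic_intr (f : R -> R) (T : R) : periodic f T ->
  forall (m : int) (a : R), f (a + m%:~R * T) = f a.
Proof.
move=> fT [m|m] a; first by rewrite mulr_natl periodicn.
rewrite NegzE mulrNz mulNr -pmulrn mulr_natl.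
by rewrite -(periodicn fT m.+1 (a - T *+ m.+1)) subrK.
Qed.

Lemma periodic_trig b L j x : trig b L (x + (2 * pi) *: delta_mx 0 j) = trig b L x.
Proof.
apply: eq_bigr => ck _; congr (_ * _); rewrite /wave phase_shift.
have -> : 2 * pi = pi *+ 2 :> R by rewrite mulr_natl.
by case: b; rewrite periodic_intr//; [exact: sinD2pi | exact: cosD2pi].
Qed.

Lemma trig_bound b L x : `|trig b L x| <= \sum_(ck <- L) `|ck.1%:~R|.
Proof.
apply: le_trans (ler_norm_sum _ _ _) _; apply: ler_sum => ck _.
rewrite normrM ler_piMr//.
rewrite /wave; case: b; rewrite ler_norml /=; apply/andP;
  by split; rewrite ?sin_geN1 ?sin_le1 ?cos_geN1 ?cos_le1.
Qed.

End Trig.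

Section TrigAlgebra.
Context {R : realType}.
Variable n : nat.
Implicit Types (x : 'rV[R]_n) (k l : seq int) (L : seq (int * seq int)) (b : bool).

Definition freqD k l : seq int := mkseq (fun j => k`_j + l`_j) n.
Definition freqB k l : seq int := mkseq (fun j => k`_j - l`_j) n.

Lemma phaseD k l x : phase (freqD k l) x = phase k x + phase l x.
Proof.
by rewrite /phase -big_split; apply: eq_bigr => j _; rewrite nth_mkseq// rmorphD mulrDl.
Qed.

Lemma phaseB k l x : phase (freqB k l) x = phase k x - phase l x.
Proof.
by rewrite /phase -sumrB; apply: eq_bigr => j _; rewrite nth_mkseq// rmorphB mulrBl.
Qed.

Lemma waveM b k l x : 2 * wave b k x * wave b l x =
  wave false (freqB k l) x + (if b then -1 else 1) * wave false (freqD k l) x.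
Proof.
by rewrite /wave phaseD phaseB cosB cosD; case: b; ring.
Qed.

Definition trigM b L L' : seq (int * seq int) :=
  flatten [seq [:: (p.1 * q.1, freqB p.2 q.2);
                   ((if b then - (p.1 * q.1) else p.1 * q.1), freqD p.2 q.2)] | p <- L, q <- L'].

Lemma trig_cat b L L' x : trig b (L ++ L') x = trig b L x + trig b L' x.
Proof. by rewrite /trig big_cat. Qed.

Definition trigZ (c : int) L := [seq (c * ck.1, ck.2) | ck <- L].

Lemma trig_scale b c L x : trig b (trigZ c L) x = c%:~R * trig b L x.
Proof.
by rewrite /trig big_map big_distrr; apply: eq_bigr => ck _; rewrite /= rmorphM mulrA.
Qed.

Lemma trig_mul b L L' x : trig false (trigM b L L') x = 2 * trig b L x * trig b L' x.
Proof.
rewrite /trig big_flatten big_allpairs_dep /= -mulrA big_distrlr /= big_distrr /=.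
apply: eq_bigr => p _; rewrite big_distrr; apply: eq_bigr => q _ /=.
rewrite !big_cons big_nil addr0 /=.
have -> : 2 * (p.1%:~R * wave b p.2 x * (q.1%:~R * wave b q.2 x)) =
          (p.1%:~R * q.1%:~R) * (2 * wave b p.2 x * wave b q.2 x) by ring.
by rewrite waveM; case: b; rewrite ?rmorphN rmorphM /=; ring.
Qed.

(** Products of trigonometric polynomials list many waves with equal frequency.
    Merging them keeps the lists short enough to be multiplied again. *)
Fixpoint trig_insert (p : int * seq int) L :=
  if L is q :: L' then
    if q.2 == p.2 then (p.1 + q.1, q.2) :: L' else q :: trig_insert p L'
  else [:: p].

Definition trig_collect L := foldr trig_insert [::] [seq p <- L | p.1 != 0].

Lemma trig_collectE b L x : trig b (trig_collect L) x = trig b L x.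
Proof.
have insE p L' : trig b (trig_insert p L') x = p.1%:~R * wave b p.2 x + trig b L' x.
  elim: L' => [|q L' IH] /=; first by rewrite /trig big_cons.
  case: eqP => [<-|_]; first by rewrite /trig !big_cons /= rmorphD /= mulrDl addrA.
  by move: IH; rewrite /trig !big_cons => ->; rewrite addrCA.
rewrite /trig_collect; elim: L => //= p L IH.
case: eqP => [p0|_] /=; first by rewrite IH /trig big_cons p0 mul0r add0r.
by rewrite insE IH /trig big_cons.
Qed.

Definition freq0 k := all (fun j => k`_j == 0) (iota 0 n).

Definition const_term L : int := foldr (fun p s => if freq0 p.2 then p.1 + s else s) 0 L.

End TrigAlgebra.

(** * Integration over the torus *)

Section TorusIntegral.
Context {R : realType}.
Local Notation mR := (measurableTypeR R).

Definition period_cell n : set (n.-tuple mR) := [set t | forall j, tnth t j \in `[0%R, (2 * pi)%R]].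
Arguments period_cell : clear implicits.

Lemma measurable_period_cell n : measurable (period_cell n).
Proof.
rewrite (_ : period_cell n = \bigcap_(j in [set: 'I_n]) ((fun t => tnth t j) @^-1` `[0, 2 * pi])).
  apply: fin_bigcap_measurable => // j _.
  by rewrite -[X in measurable X]setTI; apply: measurable_tnth => //; exact: measurable_itv.
by apply/seteqP; split=> [t bt j _ /=|t bt j]; [exact: bt | exact: bt].
Qed.

Lemma consT_period_cell n : @consT R n @^-1` period_cell n.+1 = `[0, 2 * pi] `*` period_cell n.
Proof.
apply/seteqP; split=> [[s t] /= bt|[s t] /= [bs bt] j].
  by split=> [|j]; [have := bt ord0 | have := bt (lift ord0 j)]; rewrite /consT ?tnth0 ?tnthS.
by case: (unliftP ord0 j) => [i|] ->; rewrite /consT ?tnth0 ?tnthS.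
Qed.

Lemma lebesgue_measure_period :
  lebesgue_measure (`[0, 2 * pi]%classic : set R) = (2 * pi)%:E.
Proof. by rewrite lebesgue_measure_itv /= lte_fin mulr_gt0 ?pi_gt0// sube0. Qed.

Lemma lebesgueT_period_cell n : lebesgueT n (period_cell n) = ((2 * pi) ^+ n)%:E :> \bar R.
Proof.
elim: n => [|n IH].
  rewrite /= diracE expr0 mem_set//.
  by move=> [].
change (pushforward (@lebesgue_measure R \x lebesgueT n)%E (@consT R n)
  (period_cell n.+1) = ((2 * pi) ^+ n.+1)%:E).
rewrite /pushforward consT_period_cell product_measure1E//; last exact: measurable_period_cell.
by rewrite [X in (_ * X)%E](IH) [X in (X * _)%E](lebesgue_measure_period) -EFinM exprS.
Qed.

Lemma continuous_cos_affine (a c : R) : continuous (fun x : R => cos (a + c * x)).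
Proof.
move=> x; apply: (@continuous_comp _ _ _ (fun x : R => a + c * x)); last exact: continuous_cos.
apply: continuousD; first exact: cst_continuous.
by apply: continuousM; [exact: cst_continuous | move=> ?; exact: cvg_id].
Qed.

Lemma integral_cos_period (m : int) (a : R) :
  (\int[@lebesgue_measure R]_(x in `[0%R, (2 * pi)%R]) (cos (a + m%:~R * x))%:E =
   (if m == 0 then 2 * pi * cos a else 0)%:E)%E.
Proof.
have pi2 : 0 < 2 * pi :> R by rewrite mulr_gt0 ?pi_gt0.
have [->|m0] := eqVneq m 0.
  under eq_integral do rewrite mul0r addr0.
  rewrite integral_cst// [X in (_ * X)%E](lebesgue_measure_period).
  by rewrite -EFinM mulrC.
have mR0 : m%:~R != 0 :> R by rewrite intr_eq0.
pose F x := sin (a + m%:~R * x) / m%:~R.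
have dF x : is_derive x (1 : R) F (cos (a + m%:~R * x)).
  pose g := fun h : R => a + m%:~R * h.
  have dg : is_derive x (1 : R) g m%:~R.
    rewrite (_ : g = cst a + (m%:~R : R) \*: (id : R -> R))//.
    by apply: is_derive_eq; rewrite add0r [LHS]mulr1.
  have dsg := @is_derive1_comp _ sin g x _ _ (is_derive_sin _) dg.
  rewrite (_ : F = m%:~R^-1 \*: (sin \o g)); last first.
    by apply/funext => h; rewrite /F mulrC.
  by apply: is_derive_eq; rewrite [LHS]mulrC mulfK.
have cF x : {for x, continuous F}.
  by apply/differentiable_continuous/derivable1_diffP; exact: (@ex_derive _ _ _ _ _ _ _ (dF x)).
rewrite (@continuous_FTC2 _ _ F)//.
- have -> : F (2 * pi) = F 0; last by rewrite subee.
  rewrite /F mulr0 addr0; congr (_ / _).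
  have -> : 2 * pi = pi *+ 2 :> R by rewrite mulr_natl.
  by rewrite periodic_intr//; exact: sinD2pi.
- by apply: continuous_subspaceT; exact: continuous_cos_affine.
- split=> [x _||].
  + exact: (@ex_derive _ _ _ _ _ _ _ (dF x)).
  + by apply: cvg_at_right_filter; exact: cF.
  + by apply: cvg_at_left_filter; exact: cF.
- by move=> x _; rewrite derive1E; exact: (@derive_val _ _ _ _ _ _ _ (dF x)).
Qed.

Lemma measurable_phase n (a : R) (m : 'I_n -> int) :
  measurable_fun [set: n.-tuple mR] (fun t => a + \sum_j (m j)%:~R * tnth t j).
Proof.
apply: measurable_funD => //; apply: measurable_sum => j.
by apply: measurable_funM => //; exact: measurable_tnth.
Qed.

Lemma measurable_cos_phase n (a : R) (m : 'I_n -> int) :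
  measurable_fun [set: n.-tuple mR] (fun t => cos (a + \sum_j (m j)%:~R * tnth t j)).
Proof.
exact: (measurableT_comp (continuous_measurable_fun (@continuous_cos R)) (measurable_phase a m)).
Qed.

Lemma integrable_bounded_period_cell n (f : n.-tuple mR -> R) (c : R) :
  measurable_fun setT f -> (forall t, `|f t| <= c) ->
  (lebesgueT n).-integrable (period_cell n) (EFin \o f).
Proof.
move=> mf fc; apply: measurable_bounded_integrable.
- exact: measurable_period_cell.
- by rewrite [X in (X < _)%E](lebesgueT_period_cell n) ltry.
- exact: measurable_funTS.
- exists c; split=> [|r cr t _]; first by rewrite num_real.
  exact: le_trans (fc t) (ltW cr).
Qed.

(** The induction splits off the first variable by Fubini. The shift a absorbs its
    phase, and the integrals over the other variables are those of the induction
    hypothesis. *)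
Lemma integral_cos_period_cell n (a : R) (m : 'I_n -> int) :
  (\int[lebesgueT n]_(t in period_cell n) (cos (a + \sum_j (m j)%:~R * tnth t j))%:E =
   (if [forall j, m j == 0] then (2 * pi) ^+ n * cos a else 0)%:E)%E.
Proof.
elim: n a m => [|n IH] a m.
  have mf : measurable_fun (period_cell 0) (fun t : 0.-tuple mR =>
      (cos (a + \sum_j (m j)%:~R * tnth t j))%:E).
    by apply/measurable_EFinP/measurable_funTS; exact: measurable_cos_phase.
  rewrite [LHS](@integral_dirac _ _ _ _ _ (@measurable_period_cell 0) _ mf).
  rewrite diracE mem_set; last by move=> [].
  rewrite mul1e big_ord0 addr0 expr0 mul1r.
  by case: forallP => // -[] [].
pose f := fun t : n.+1.-tuple mR => cos (a + \sum_j (m j)%:~R * tnth t j).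
pose m' := fun j => m (lift ord0 j).
have fcons s t : f (consT (s, t)) =
    cos (a + (m ord0)%:~R * s + \sum_j (m' j)%:~R * tnth t j).
  rewrite /f big_ord_recl -addrA tnth0; congr (cos (_ + (_ + _))).
  by apply: eq_bigr => j _; rewrite tnthS.
have cos1 t : `|f t| <= 1 by rewrite ler_norml cos_geN1 cos_le1.
have mf : measurable_fun [set: n.+1.-tuple mR] f by exact: measurable_cos_phase.
have mfE : measurable_fun [set: n.+1.-tuple mR] (EFin \o f) by exact/measurable_EFinP.
have mA : measurable (`[0, 2 * pi]%classic : set mR) by exact: measurable_itv.
have mB := @measurable_period_cell n.
have prod_fin : ((@lebesgue_measure R \x lebesgueT n)
    (`[0%R, (2 * pi)%R] `*` period_cell n) < +oo)%E.
  rewrite product_measure1E// [X in (X * _)%E](lebesgue_measure_period).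
  by rewrite [X in (_ * X)%E](lebesgueT_period_cell n) -EFinM ltry.
have intf : (@lebesgue_measure R \x lebesgueT n)%E.-integrable
    (@consT R n @^-1` period_cell n.+1) ((EFin \o f) \o @consT R n).
  rewrite consT_period_cell; apply: (@measurable_bounded_integrable _ _ _ _ (f \o @consT R n)).
  - exact: measurableX.
  - exact: prod_fin.
  - by apply: measurable_funTS; apply: measurableT_comp => //; exact: measurable_consT.
  - exists 1; split=> [|r cr t _]; first by rewrite num_real.
    exact: le_trans (cos1 _) (ltW cr).
have mconsT := @measurable_consT R n.
rewrite [LHS](_ : _ =
  \int[pushforward (@lebesgue_measure R \x lebesgueT n)%E (@consT R n)]_(t in period_cell n.+1) (EFin \o f) t)%E//.
rewrite integral_pushforward//; last exact: measurable_period_cell.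
rewrite consT_period_cell integral_mkcond -integral12_prod_meas1; last first.
  rewrite -integrable_mkcond; last exact: measurableX.
  by rewrite -consT_period_cell.
pose v := (if [forall j, m' j == 0] then (2 * pi) ^+ n else 0 : R).
pose h (s : mR) : \bar R := (v * cos (a + (m ord0)%:~R * s))%:E.
transitivity (\int[@lebesgue_measure R]_s (h \_ `[0%R, (2 * pi)%R]) s)%E.
  apply: eq_integral => s _; rewrite !patchE; case: ifPn => sA.
    have -> : h s = (if [forall j, m' j == 0]
        then (2 * pi) ^+ n * cos (a + (m ord0)%:~R * s) else 0)%:E.
      by rewrite /h /v; case: ifP => _; rewrite ?mul0r.
    rewrite -IH [RHS]integral_mkcond; apply: eq_integral => t _.
    rewrite !patchE in_setX sA /=; case: ifP => // _.
    by rewrite fcons.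
  by apply: integral0_eq => t _; rewrite patchE in_setX (negPf sA).
rewrite -integral_mkcond /h; under eq_integral do rewrite EFinM.
have icos : (@lebesgue_measure R).-integrable (`[0, 2 * pi]%classic : set R)
    (EFin \o (fun s : R => cos (a + (m ord0)%:~R * s))).
  apply: continuous_compact_integrable; first exact: segment_compact.
  by apply: continuous_subspaceT; exact: continuous_cos_affine.
rewrite integralZl//.
rewrite [X in (_ * X)%E]integral_cos_period -EFinM; congr EFin.
have -> : [forall j, m j == 0] = (m ord0 == 0) && [forall j, m' j == 0].
  apply/forallP/andP => [m0|[m0 /forallP m'0] j].
    by split; [exact: m0 | apply/forallP => j; exact: m0].
  by case: (unliftP ord0 j) => [i ->|->//]; exact: m'0.
rewrite /v; case: (m ord0 == 0) => /=; last by rewrite mulr0.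
by case: ifP => _; rewrite ?mul0r// exprS; ring.
Qed.

End TorusIntegral.
Arguments period_cell {R} n.

Section TorusMean.
Context {R : realType}.
Variable n : nat.
Local Notation mR := (measurableTypeR R).
Implicit Types (k : seq int) (L : seq (int * seq int)) (f g : 'rV[R]_n -> R).

Definition torus_fun f (t : n.-tuple mR) : R := f (\row_j tnth t j).

Definition bounded_mfun f := measurable_fun setT (torus_fun f) /\ exists c : R, forall x, `|f x| <= c.

Lemma bounded_mfun_integrable f : bounded_mfun f ->
  (lebesgueT n).-integrable (period_cell n) (EFin \o torus_fun f).
Proof. by move=> [mf [c fc]]; apply: (integrable_bounded_period_cell (c := c)) => // t; exact: fc. Qed.

Lemma torus_intE f : torus_int f = \int[lebesgueT n]_(t in period_cell n) torus_fun f t.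
Proof. by []. Qed.

Lemma le_torus_int f g : bounded_mfun f -> bounded_mfun g -> (forall x, f x <= g x) ->
  torus_int f <= torus_int g.
Proof.
move=> tf tg fg; rewrite !torus_intE.
by apply: le_Rintegral; [exact: measurable_period_cell |
  exact: bounded_mfun_integrable | exact: bounded_mfun_integrable | move=> t _; exact: fg].
Qed.

Lemma torus_intD f g : bounded_mfun f -> bounded_mfun g ->
  torus_int (fun x => f x + g x) = torus_int f + torus_int g.
Proof.
move=> tf tg; rewrite !torus_intE; apply: RintegralD;
  [exact: measurable_period_cell | exact: bounded_mfun_integrable |
   exact: bounded_mfun_integrable].
Qed.

Lemma torus_intZ (c : R) f : bounded_mfun f -> torus_int (fun x => c * f x) = c * torus_int f.
Proof.
by move=> tf; rewrite !torus_intE; apply: RintegralZl;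
  [exact: measurable_period_cell | exact: bounded_mfun_integrable].
Qed.

Lemma torus_int_cst (c : R) : torus_int (fun _ : 'rV[R]_n => c) = c * (2 * pi) ^+ n.
Proof.
rewrite torus_intE [LHS]Rintegral_cst; last exact: measurable_period_cell.
by rewrite [X in fine X](lebesgueT_period_cell n).
Qed.

Lemma bounded_mfun_cst (c : R) : bounded_mfun (fun=> c).
Proof. by split; [exact: measurable_cst | exists `|c|]. Qed.

Lemma bounded_mfunD f g : bounded_mfun f -> bounded_mfun g -> bounded_mfun (fun x => f x + g x).
Proof.
move=> [mf [c fc]] [mg [d gd]]; split; first exact: measurable_funD.
by exists (c + d) => x; rewrite (le_trans (ler_normD _ _))// lerD.
Qed.

Lemma bounded_mfunM f g : bounded_mfun f -> bounded_mfun g -> bounded_mfun (fun x => f x * g x).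
Proof.
move=> [mf [c fc]] [mg [d gd]]; split; first exact: measurable_funM.
by exists (c * d) => x; rewrite normrM ler_pM.
Qed.

Lemma bounded_mfun_sqrt f : bounded_mfun f -> bounded_mfun (fun x => Num.sqrt (f x)).
Proof.
move=> [mf [c fc]]; split.
  exact: (measurableT_comp (continuous_measurable_fun (@sqrt_continuous R)) mf).
exists (Num.sqrt c) => x; rewrite ger0_norm ?sqrtr_ge0// ler_wsqrtr//.
exact: le_trans (ler_norm _) (fc x).
Qed.

Lemma bounded_mfun_trig L : bounded_mfun (trig false L).
Proof.
split; last by exists (\sum_(ck <- L) `|ck.1%:~R|) => x; exact: trig_bound.
apply: measurable_sum => ck; apply: measurable_funM; first exact: measurable_cst.
rewrite (_ : (fun t => _) = (fun t : n.-tuple mR =>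
    cos (0 + \sum_(j < n) (ck.2`_j)%:~R * tnth t j))); first exact: measurable_cos_phase.
apply/funext => t; rewrite /wave /phase add0r; congr cos.
by apply: eq_bigr => j _; rewrite mxE.
Qed.

Lemma torus_int_wave k :
  torus_int (@wave R n false k) = if freq0 n k then (2 * pi) ^+ n else 0.
Proof.
have -> : freq0 n k = [forall j : 'I_n, k`_j == 0].
  apply/allP/forallP => [k0 j|k0 i]; first by apply: k0; rewrite mem_iota /= ltn_ord.
  by rewrite mem_iota /= => i_n; exact: (k0 (Ordinal i_n)).
rewrite torus_intE /Rintegral.
rewrite (_ : (\int[_]_(t in _) _)%E = (\int[lebesgueT n]_(t in period_cell n)
    (cos (0 + \sum_(j < n) (k`_j)%:~R * tnth t j))%:E)%E); last first.
  apply: eq_integral => t _; rewrite /torus_fun /wave /phase add0r; congr (EFin (cos _)).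
  by apply: eq_bigr => j _; rewrite mxE.
rewrite (integral_cos_period_cell 0 (fun j => k`_j)) cos0 mulr1.
by case: ifP.
Qed.

Lemma torus_int_trig L :
  torus_int (@trig R n false L) = (const_term n L)%:~R * (2 * pi) ^+ n.
Proof.
elim: L => [|[c k] L IH].
  rewrite (_ : trig false [::] = fun=> 0); last by apply/funext => x; rewrite /trig big_nil.
  by rewrite torus_int_cst.
have tw : bounded_mfun (@wave R n false k).
  rewrite (_ : wave false k = trig false [:: (1, k)]); first exact: bounded_mfun_trig.
  by apply/funext => x; rewrite /trig big_seq1 mul1r.
rewrite trig_cons torus_intD;
  [|exact: bounded_mfunM (bounded_mfun_cst _) tw|exact: bounded_mfun_trig].
rewrite torus_intZ// torus_int_wave IH /=.
by case: ifP => _; [rewrite intrD [RHS]mulrDl | rewrite mulr0 add0r].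
Qed.

End TorusMean.

(** * A periodic map that lowers the mean of the integrand *)

Section Counterexample.
Context {R : realType}.

(** Frequencies and coefficients of c psi(p1 x + p2 y, p1 X + p2 Y), where
    psi(s, t) = 2 cos s + 2 cos t + cos (s + t) + cos (s - t)
              = 2 (1 + cos s) (1 + cos t) - 2. *)
Definition potential (p1 p2 c : int) : seq (int * seq int) :=
  [seq (c * w.1, [:: p1 * w.2.1; p1 * w.2.2; p2 * w.2.1; p2 * w.2.2]) |
     w <- [:: (2, (1, 0)); (2, (0, 1)); (1, (1, 1)); (1, (1, -1))]].

(** f = psi(p + q) - psi(q) and g = psi(p) - psi(p + q), for p = (x, X) and
    q = (y, Y). *)
Definition test_waves (i : 'I_2) : seq (int * seq int) :=
  if i == 0 then potential 1 1 1 ++ potential 0 1 (-1)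
  else potential 1 0 1 ++ potential 1 1 (-1).

Definition test_map (e : R) (x : 'rV[R]_4) : 'rV[R]_2 :=
  \row_i (e * trig false (test_waves i) x).

Lemma test_map_smooth e : smooth_torus (test_map e).
Proof.
split=> [j x|i].
  by apply/rowP => i; rewrite !mxE periodic_trig.
rewrite (_ : (fun x => _) = (fun x => e * trig false (test_waves i) x)).
  exact: smooth_trig.
by apply/funext => x; rewrite mxE.
Qed.

Definition slope (i : 'I_2) (j : nat) :=
  trig_collect (dtrig false (inord j : 'I_4) (test_waves i)).

Lemma grad_test_map e x i (j : 'I_4) :
  grad (test_map e) x i j = e * trig true (slope i j) x.
Proof.
rewrite mxE (_ : (fun y => _) = (fun y => e * trig false (test_waves i) y)).
  by rewrite partial_trig /slope inord_val trig_collectE.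
by apply/funext => y; rewrite mxE.
Qed.

Definition cross L1 L2 K1 K2 :=
  trig_collect (trigM 4 true L1 K2 ++ trigZ (-1) (trigM 4 true L2 K1)).

Lemma crossE L1 L2 K1 K2 (x : 'rV[R]_4) : trig false (cross L1 L2 K1 K2) x =
  2 * (trig true L1 x * trig true K2 x - trig true L2 x * trig true K1 x).
Proof. by rewrite trig_collectE trig_cat trig_scale !trig_mul; ring. Qed.

(** Products of waves are expanded as 2 sin k sin l = cos (k - l) - cos (k + l) and
    alike, which keeps the coefficients integral; hence the factor 2 in
    [quadratic_formE] and the factor 8 in [quartic_formE]. *)
Definition quadratic_form (A1 A2 B1 B2 C1 C2 : seq (int * seq int)) :=
  trigM 4 true A1 A1 ++ trigM 4 true A2 A2 ++ trigM 4 true B1 C1 ++ trigM 4 true B2 C2.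

Lemma quadratic_formE A1 A2 B1 B2 C1 C2 (x : 'rV[R]_4) :
  let T L := trig true L x in
  trig false (quadratic_form A1 A2 B1 B2 C1 C2) x =
  2 * (T A1 ^+ 2 + T A2 ^+ 2 + T B1 * T C1 + T B2 * T C2).
Proof. by rewrite /= /quadratic_form !trig_cat !trig_mul; ring. Qed.

Definition quartic_form (A1 A2 B1 B2 C1 C2 : seq (int * seq int)) :=
  let bc := cross B1 B2 C1 C2 in
  let ab := cross A1 A2 B1 B2 in
  let ac := cross A1 A2 C1 C2 in
  trigM 4 false bc bc ++ trigZ (-4) (trigM 4 false ab ac).

Lemma quartic_formE A1 A2 B1 B2 C1 C2 (x : 'rV[R]_4) :
  let T L := trig true L x in
  trig false (quartic_form A1 A2 B1 B2 C1 C2) x =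
  8 * ((T B1 * T C2 - T B2 * T C1) ^+ 2 -
       4 * (T A1 * T B2 - T A2 * T B1) * (T A1 * T C2 - T A2 * T C1)).
Proof. by rewrite /= /quartic_form !trig_cat trig_scale !trig_mul !crossE; ring. Qed.

Definition quadratic_waves := quadratic_form
  (slope 0 0) (slope 0 1) (slope 0 2) (slope 0 3) (slope 1 0) (slope 1 1).

Definition quartic_waves := quartic_form
  (slope 0 0) (slope 0 1) (slope 0 2) (slope 0 3) (slope 1 0) (slope 1 1).

Lemma ordE (j : nat) (h : (j < 4)%N) : inord j = Ordinal h.
Proof. by apply: val_inj; rewrite /= inordK. Qed.

(** f_x + g_y = 0 and f_X + g_Y = 0: each psi term of direction (mu1, mu2) enters
    (f, g) with amplitude proportional to (- mu2, mu1). *)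
Lemma slope_traceless (j : nat) : (j < 2)%N -> slope 1 j.+2 = trigZ (-1) (slope 0 j).
Proof.
rewrite /slope; case: j => [|[|//]] _.
  by rewrite (@ordE 0 isT) (@ordE 2 isT); vm_compute.
by rewrite (@ordE 1 isT) (@ordE 3 isT); vm_compute.
Qed.

(** A combination of 2 x 2 minors of the gradient of a periodic map, the
    quadratic term has mean zero. *)
Lemma mean_quadratic_waves : const_term 4 quadratic_waves = 0.
Proof.
rewrite /quadratic_waves /slope (@ordE 0 isT) (@ordE 1 isT) (@ordE 2 isT) (@ordE 3 isT).
by vm_compute.
Qed.

(** The point of the whole construction: the mean is negative, although every
    single plane wave, and every pair of plane waves, contributes a nonnegative
    amount; resonant quadruples of waves outweigh them. *)
Lemma mean_quartic_waves : const_term 4 quartic_waves = -48.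
Proof.
rewrite /quartic_waves /slope (@ordE 0 isT) (@ordE 1 isT) (@ordE 2 isT) (@ordE 3 isT).
by vm_compute.
Qed.

Lemma F24_test_map (e : R) x : F24 (0 + grad (test_map e) x) ^+ 2 =
  (1 + e ^+ 2 / 2 * trig false quadratic_waves x) ^+ 2 +
  e ^+ 4 / 8 * trig false quartic_waves x.
Proof.
have rescale (a1 a2 b1 b2 c1 c2 : R) :
    (1 + ((e * a1) ^+ 2 + (e * a2) ^+ 2 + e * b1 * (e * c1) + e * b2 * (e * c2))) ^+ 2 +
    ((e * b1 * (e * c2) - e * b2 * (e * c1)) ^+ 2 -
     4 * (e * a1 * (e * b2) - e * a2 * (e * b1)) * (e * a1 * (e * c2) - e * a2 * (e * c1))) =
    (1 + e ^+ 2 / 2 * (2 * (a1 ^+ 2 + a2 ^+ 2 + b1 * c1 + b2 * c2))) ^+ 2 +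
    e ^+ 4 / 8 * (8 * ((b1 * c2 - b2 * c1) ^+ 2 -
      4 * (a1 * b2 - a2 * b1) * (a1 * c2 - a2 * c1))) by field.
pose s i j := e * trig true (slope i j) x.
rewrite (@F24_traceless _ _ (s 0 0%N) (s 0 1%N) (s 0 2%N) (s 0 3%N) (s 1 0%N) (s 1 1%N)).
  by rewrite quadratic_formE quartic_formE; exact: rescale.
have tr j : (j < 2)%N -> s 1 j.+2 = - s 0 j.
  by move=> j2; rewrite /s slope_traceless// trig_scale mulN1r mulrN.
rewrite add0r -!tr//; apply/matrixP => i j; rewrite grad_test_map mxE -/(s i j).
case: i => -[|[|//]] hi; case: j => -[|[|[|[|//]]]] hj /=;
  by congr (s _ _); apply: val_inj.
Qed.

Lemma F24_0 : F24 (0 : 'M[R]_(2, 4)) = 1.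
Proof.
apply/eqP; rewrite -(eqrXn2 (n := 2)) ?F24_ge0//; apply/eqP.
rewrite (@F24_traceless _ _ 0 0 0 0 0 0).
  rewrite expr1n; ring.
apply/matrixP => i j; rewrite !mxE.
by case: i => -[|[|//]] hi; case: j => -[|[|[|[|//]]]] hj; rewrite /= ?oppr0.
Qed.

(** By the arithmetic-geometric mean inequality 2 c S <= c^2 + S^2 for c = 1 + d m,
    hence S <= c + d^2 h / (2 c); replacing 1 / c by 1 costs a term of third order
    in d. *)
Lemma sqrt_perturb (S d m h K1 K2 : R) : 0 <= d -> `|m| <= K1 -> `|h| <= K2 -> d * K1 <= 2^-1 ->
  S ^+ 2 = (1 + d * m) ^+ 2 + d ^+ 2 * h ->
  S - 1 <=
  d * m + d ^+ 2 / 2 * h + d ^+ 3 * K1 * K2.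
Proof.
move=> d0 mK hK dK SE.
have dm : `|d * m| <= d * K1 by rewrite normrM (ger0_norm d0) ler_wpM2l.
set c := 1 + d * m.
have c2 : 2^-1 <= c.
  rewrite /c; move: (le_trans dm dK); rewrite ler_norml => /andP[]; lra.
have SS : S ^+ 2 = c ^+ 2 + d ^+ 2 * h by [].
have amgm : 2 * c * S <= 2 * c ^+ 2 + d ^+ 2 * h.
  have := sqr_ge0 (S - c); rewrite sqrrB SS; lra.
have K10 : 0 <= K1 by exact: le_trans (normr_ge0 _) mK.
have K20 : 0 <= K2 by exact: le_trans (normr_ge0 _) hK.
have mh : - (d * m * h) <= d * K1 * K2.
  apply: le_trans (ler_norm _) _; rewrite normrN normrM.
  by apply: ler_pM.
rewrite -(ler_pM2l (_ : 0 < 2 * c)); last by lra.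
have e0 : 0 <= d ^+ 3 * K1 * K2 by rewrite !mulr_ge0// exprn_ge0.
have e1 : d ^+ 3 * K1 * K2 <= 2 * c * (d ^+ 3 * K1 * K2).
  by rewrite ler_peMl//; lra.
have d2mh : d ^+ 2 * - (d * m * h) <= d ^+ 2 * (d * K1 * K2).
  by rewrite ler_wpM2l// exprn_ge0.
have -> : 2 * c * (d * m + d ^+ 2 / 2 * h + d ^+ 3 * K1 * K2) =
  2 * c ^+ 2 - 2 * c + d ^+ 2 * h + d ^+ 2 * (d * m * h) + 2 * c * (d ^+ 3 * K1 * K2).
  by rewrite /c; field.
rewrite mulrBr mulr1; move: e1 d2mh amgm.
have -> : d ^+ 3 * K1 * K2 = d ^+ 2 * (d * K1 * K2) by ring.
lra.
Qed.

Lemma F24_not_quasiconvex : ~ quasiconvex (@F24 R).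
Proof.
move=> qc.
pose m (x : 'rV[R]_4) := 2^-1 * trig false quadratic_waves x.
pose h (x : 'rV[R]_4) := 8^-1 * trig false quartic_waves x.
have tm : bounded_mfun m.
  by apply: bounded_mfunM; [exact: bounded_mfun_cst | exact: bounded_mfun_trig].
have th : bounded_mfun h.
  by apply: bounded_mfunM; [exact: bounded_mfun_cst | exact: bounded_mfun_trig].
have [_ [K1 mK]] := tm; have [_ [K2 hK]] := th.
have K10 : 0 <= K1 by exact: le_trans (normr_ge0 _) (mK 0).
have K20 : 0 <= K2 by exact: le_trans (normr_ge0 _) (hK 0).
have K12 : 0 <= K1 * K2 by rewrite mulr_ge0.
(* d is small against 1 / K1 and 1 / (K1 K2), so that the third-order error stays
   below the gain 3 d^2 obtained from the mean -6 of h. *)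
pose N := 1 + K1 + K1 * K2.
pose d := (2 * N)^-1.
have N0 : 0 < N by rewrite /N; lra.
have d0 : 0 < d by rewrite invr_gt0 mulr_gt0.
have dN : d * N = 2^-1 by rewrite /d; field; lra.
have dK1 : d * K1 <= 2^-1.
  by rewrite -dN ler_pM2l// /N; lra.
have dK12 : d * (K1 * K2) <= 2^-1.
  by rewrite -dN ler_pM2l// /N; lra.
pose e := Num.sqrt d.
have e2 : e ^+ 2 = d by rewrite sqr_sqrtr// ltW.
have FE x : F24 (0 + grad (test_map e) x) ^+ 2 = (1 + d * m x) ^+ 2 + d ^+ 2 * h x.
  rewrite F24_test_map -[4%N]/(2 * 2)%N exprM e2 /m /h.
  by rewrite !mulrA.
pose P : R := (2 * pi) ^+ 4.
have P0 : 0 < P by rewrite exprn_gt0// mulr_gt0// pi_gt0.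
have intm : torus_int m = 0.
  by rewrite (torus_intZ _ (bounded_mfun_trig _ _)) torus_int_trig mean_quadratic_waves mul0r mulr0.
have inth : torus_int h = -6 * P.
  by rewrite (torus_intZ _ (bounded_mfun_trig _ _)) torus_int_trig mean_quartic_waves -/P; field.
have := qc 0 (test_map e) (test_map_smooth e).
suff : torus_int (fun x => F24 (0 + grad (test_map e) x) - F24 (0 : 'M[R]_(2,4))) < 0.
  by rewrite ltNge => /negP.
have tF : bounded_mfun (fun x => F24 (0 + grad (test_map e) x) - F24 (0 : 'M[R]_(2,4))).
  apply: bounded_mfunD; last exact: bounded_mfun_cst.
  under eq_fun do rewrite -[F24 _]ger0_norm ?F24_ge0// -sqrtr_sqr FE expr2.
  apply: bounded_mfun_sqrt; apply: bounded_mfunD; last first.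
    by apply: bounded_mfunM => //; exact: bounded_mfun_cst.
  by apply: bounded_mfunM; (apply: bounded_mfunD; first exact: bounded_mfun_cst);
    apply: bounded_mfunM => //; exact: bounded_mfun_cst.
have tdm : bounded_mfun (fun x => d * m x).
  by apply: bounded_mfunM => //; exact: bounded_mfun_cst.
have tdh : bounded_mfun (fun x => d ^+ 2 / 2 * h x).
  by apply: bounded_mfunM => //; exact: bounded_mfun_cst.
have tG : bounded_mfun (fun x => d * m x + d ^+ 2 / 2 * h x) by exact: bounded_mfunD.
apply: le_lt_trans (le_torus_int tF
  (g := fun x => d * m x + d ^+ 2 / 2 * h x + d ^+ 3 * K1 * K2) _ _) _.
- by apply: bounded_mfunD => //; exact: bounded_mfun_cst.
- by move=> x; rewrite F24_0; apply: sqrt_perturb => //; exact: ltW.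
rewrite torus_intD//; last exact: bounded_mfun_cst.
rewrite torus_int_cst torus_intD// (torus_intZ _ tm) (torus_intZ _ th) intm inth.
have -> : d * 0 + d ^+ 2 / 2 * (-6 * P) + d ^+ 3 * K1 * K2 * P =
  d ^+ 2 * (d * (K1 * K2) - 3) * P by field.
by rewrite pmulr_llt0// pmulr_rlt0 ?exprn_gt0//; lra.
Qed.

End Counterexample.

Theorem corollary1p3 (R : realType) :
  exists F : 'M[R]_(2, 4) -> R,
    [/\ forall A, 0 <= F A,
        locally_lipschitz F,
        exists (M : 'M[R]_(2, 6)) (iota : {linear 'M[R]_(2, 4) -> 'M[R]_(2, 6)}),
          injective iota /\ forall A, F A = GimT (M + iota A),
        rank_one_convex F &
        ~ quasiconvex F].
Proof.
exists (@F24 R); split.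
- exact: F24_ge0.
- exact: F24_locally_lipschitz.
- by exists (@slice_base R), (mulmxr (@slice_embed R)); split; [exact: slice_embed_inj |].
- exact: F24_rank_one_convex.
- exact: F24_not_quasiconvex.
Qed.
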